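(* Let $\mathbb{T}=\mathbb{N}_0$ and suppose there is a sequence $\{\bar g(t)\}_{t\in\mathbb{T}}\in H_{\mathcal{F}}$ such that $|\tilde g_{i,j}(t)|\le\bar g(t)$ for all $(t,i,j)\in\mathbb{T}\times\mathcal{I}^2$. The system of infinite-horizon reflected backward stochastic difference equations: for all $i\in\mathcal{I}$, $$\begin{cases} Y^i_t = Y^{i}_{T} + \sum_{s=t}^{T-1}\rho_s(g_{i}(s)+\Delta M^i_{s+1})-(M^i_T-M^i_t)-(A^i_{T}-A^i_t),\quad \forall\, t,T\in\mathbb{T}\text{ with } t\le T,\\ Y^i_t \le \min_{j\in\mathcal{I}\setminus\{i\}} \rho_t(\tilde{g}_{i,j}(t)+Y^j_{t+1}),\quad\forall\, t\in\mathbb{T},\\ \sum_{t\in\mathbb{T}}\big(Y^i_t - \min_{j\in\mathcal{I}\setminus\{i\}} \rho_t(\tilde{g}_{i,j}(t)+Y^j_{t+1})\big)\Delta A^i_{t+1}=0, \end{cases}$$ has a unique solution $(Y,M,A)$. Furthermore, the solution satisfies $Y=V$, where $V=(V^i)_{i\in\mathcal{I}}$ is the value process of the infinite-horizon switching problem, $$V_t^{i} = \operatorname*{ess\,inf}_{\xi\in\mathcal{U}^i_t}\varrho_{t}\big(\tilde g_{\xi_{t-1},\xi_t}(t),\tilde g_{\xi_{t},\xi_{t+1}}(t+1),\ldots\big).$$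
   Context: $(\Omega,\mathcal{F},\mathbb{P})$ is a probability space and $\mathbb{G}=\{\mathcal{G}_t\}_{t\in\mathbb{T}}$ is a filtration of sub-$\sigma$-algebras of $\mathcal{F}$. $L^\infty_{\mathcal{H}}$ denotes the space of essentially bounded $\mathcal{H}$-measurable random variables. All (in)equalities between random variables are $\mathbb{P}$-almost sure. A $\mathbb{G}$-conditional risk mapping is a family $\rho=\{\rho_t\}_{t\in\mathbb{T}}$, $\rho_t:L^\infty_{\mathcal{F}}\to L^\infty_{\mathcal{G}_t}$, satisfying for all $t$: normalisation $\rho_t(0)=0$; conditional translation invariance $\rho_t(Z+W)=Z+\rho_t(W)$ for $W\in L^\infty_{\mathcal{F}}$, $Z\in L^\infty_{\mathcal{G}_t}$; monotonicity: $W\le Z$ implies $\rho_t(W)\le\rho_t(Z)$ for $W,Z\in L^\infty_{\mathcal F}$. Such a $\rho$ is fixed. The aggregated risk mapping is $\rho_{t,t}(W_t)=\rho_t(W_t)$ and, for $s<t$, $\rho_{s,t}(W_s,\ldots,W_t)=\rho_s\big(W_s+\rho_{s+1}(W_{s+1}+\cdots+\rho_{t-1}(W_{t-1}+\rho_t(W_t))\cdots)\big)$. The infinite-horizon aggregated risk mapping is $\varrho_s(W_s,W_{s+1},\ldots)=\limsup_{t\to\infty}\rho_{s,t}(W_s,\ldots,W_t)$ for sequences in $L^\infty_{\mathcal{F}}$. $H_{\mathcal{F}}$ is the set of sequences $W=\{W_t\}_{t\in\mathbb{T}}$ in $L^\infty_{\mathcal{F}}$ for which there is a non-negative deterministic sequence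 $\{k_t\}_{t\in\mathbb{T}}$ with $\sum_t k_t<\infty$ and $|W_t|\le k_t$ for all $t$. $\mathcal{L}^\infty_{\mathbb{G}}=\otimes_{t\in\mathbb{T}}L^\infty_{\mathcal{G}_t}$ is the set of sequences $(W_t)_{t\in\mathbb{T}}$ with $W_t\in L^\infty_{\mathcal{G}_t}$, and $\mathcal{L}^{\infty,d}_{\mathbb{G}}=\{W\in\mathcal{L}^\infty_{\mathbb{G}}:\lim_{s\to\infty}\operatorname{ess\,sup}_\omega|W_s(\omega)|=0\}$; for $\mathbb{R}^m$-valued processes membership and all properties are understood component-wise. $\mathcal{I}=\{1,\ldots,m\}$ is a finite set of modes; $g_i(t)$ and $c_{i,j}(t)$ ($i,j\in\mathcal{I}$, $t\in\mathbb{T}$) are random variables in $L^\infty_{\mathcal{F}}$ (not assumed $\mathbb{G}$-adapted) with $c_{i,i}(t)=0$, and $\tilde g_{i,j}(t)=g_j(t)+c_{i,j}(t)$. A strategy is an $\mathcal{I}$-valued, $\mathbb{G}$-adapted random sequence $\xi=(\xi_t)_{t\in\{-1\}\cup\mathbb{T}}$ (with $\xi_{-1}$ the initial mode), and $\mathcal{U}^i_t$ is the set of strategies with $\xi_{t-1}=i$. $\Delta X_{t+1}=X_{t+1}-X_t$. $M\in\mathcal{L}^\infty_{\mathbb{G}}$ is a $\rho_{s,t}$-martingale if $M_s=\rho_{s,t}(0,\ldots,0,M_t)$ for all $0\le s\le t$. $A$ is $\mathbb{G}$-predictable if $A_{t+1}$ is $\mathcal{G}_t$-measurable for all $t\in\mathbb{T}$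 (and $A_0$ is constant). A solution of the system is a triple $(Y,M,A)\in\mathcal{L}^{\infty,d}_{\mathbb{G}}\times(\mathcal{L}^\infty_{\mathbb{G}})^2$ of $\mathbb{R}^m$-valued processes with $M$ a $\rho_{s,t}$-martingale, $A$ a $\mathbb{G}$-predictable non-decreasing process, $M_0=A_0=0$, satisfying the system. It is unique if any other solution is indistinguishable from it. Conventions: $\min\emptyset=\infty$ and $\pm\infty\cdot 0=0$. *)

(* Defs.v *)
From HB Require Import structures.
From mathcomp Require Import all_boot all_order all_algebra.
From mathcomp Require Import all_classical all_reals all_analysis.
From mathcomp Require Import measurable_realfun ess_sup_inf.

Set Implicit Arguments.
Unset Strict Implicit.
Unset Printing Implicit Defensive.

Import Order.TTheory GRing.Theory Num.Theory.
Import numFieldNormedType.Exports.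

Local Open Scope classical_set_scope.
Local Open Scope ring_scope.

(* Random variables are represented by functions T -> R.  Relations between
   them are almost sure, so every notion below is invariant under
   modification on null sets; the class of X belongs to a space of
   H-measurable variables when it has an H-measurable representative. *)

Record filtration (d : measure_display) (T : measurableType d)
    (G : nat -> set (set T)) : Prop := Filtration {
  filtration_sigma_algebra : forall t, sigma_algebra [set: T] (G t) ;
  filtration_sub : forall t, G t `<=` @measurable d T ;
  filtration_le : forall s t, (s <= t)%N -> G s `<=` G t }.

Definition measurable_wrt (d : measure_display) (T : measurableType d)
    (R : realType) (H : set (set T)) (X : T -> R) : Prop :=
  measurable_fun [set: g_sigma_algebraType H] (X : g_sigma_algebraType H -> R).

Definition ess_norm (d : measure_display) (T : measurableType d)
    (R : realType) (P : probability T R) (X : T -> R) : \bar R :=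
  ess_sup P (fun w => `|X w|%:E).

Definition Linfty (d : measure_display) (T : measurableType d)
    (R : realType) (P : probability T R) (H : set (set T)) (X : T -> R) : Prop :=
  measurable_wrt H X /\ (ess_norm P X < +oo)%E.

Definition LinftyF (d : measure_display) (T : measurableType d)
    (R : realType) (P : probability T R) (X : T -> R) : Prop :=
  Linfty P (@measurable d T) X.

Definition adapted_Linfty (d : measure_display) (T : measurableType d)
    (R : realType) (P : probability T R) (G : nat -> set (set T))
    (X : nat -> T -> R) : Prop :=
  forall t, Linfty P (G t) (X t).

Definition adapted_Linfty_vanishing (d : measure_display)
    (T : measurableType d) (R : realType) (P : probability T R)
    (G : nat -> set (set T)) (X : nat -> T -> R) : Prop :=
  adapted_Linfty P G X /\
  ess_norm P (X s) @[s --> \oo] --> (0 : \bar R).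

Definition HF (d : measure_display) (T : measurableType d) (R : realType)
    (P : probability T R) (W : nat -> T -> R) : Prop :=
  (forall t, LinftyF P (W t)) /\
  exists k : nat -> R,
    [/\ forall t, 0 <= k t,
        cvgn (series k) &
        forall t, \forall w \ae P, `|W t w| <= k t].

(* Monotonicity makes rho t compatible with almost sure equality, so rho t
   does induce a map between spaces of classes. *)
Record conditional_risk_mapping (d : measure_display) (T : measurableType d)
    (R : realType) (P : probability T R) (G : nat -> set (set T))
    (rho : nat -> (T -> R) -> (T -> R)) : Prop := ConditionalRiskMapping {
  risk_Linfty : forall t W, LinftyF P W -> Linfty P (G t) (rho t W) ;
  risk_normalised : forall t, \forall w \ae P, rho t (fun=> 0) w = 0 ;
  risk_translation : forall t W Z, LinftyF P W -> Linfty P (G t) Z ->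
    \forall w \ae P, rho t (fun w' => Z w' + W w') w = Z w + rho t W w ;
  risk_monotone : forall t W Z, LinftyF P W -> LinftyF P Z ->
    (\forall w \ae P, W w <= Z w) ->
    \forall w \ae P, rho t W w <= rho t Z w }.

Fixpoint aggregate_steps (T : Type) (R : realType)
    (rho : nat -> (T -> R) -> (T -> R)) (n s : nat) (W : nat -> T -> R)
    : T -> R :=
  if n is n'.+1
  then rho s (fun w => W s w + aggregate_steps rho n' s.+1 W w)
  else rho s (W s).

(* rho_{s,t}(W_s, ..., W_t); meaningful for s <= t only. *)
Definition aggregated_risk (T : Type) (R : realType)
    (rho : nat -> (T -> R) -> (T -> R)) (s t : nat) (W : nat -> T -> R)
    : T -> R :=
  aggregate_steps rho (t - s) s W.

Definition aggregated_risk_infty (T : Type) (R : realType)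
    (rho : nat -> (T -> R) -> (T -> R)) (s : nat) (W : nat -> T -> R)
    : T -> \bar R :=
  fun w => limn_esup (fun t => (aggregated_risk rho s t W w)%:E).

Definition risk_martingale (d : measure_display) (T : measurableType d)
    (R : realType) (P : probability T R)
    (rho : nat -> (T -> R) -> (T -> R)) (M : nat -> T -> R) : Prop :=
  forall s t, (s <= t)%N ->
    \forall w \ae P, M s w =
      aggregated_risk rho s t (fun u => if u == t then M t else fun=> 0) w.

Definition predictable (d : measure_display) (T : measurableType d)
    (R : realType) (P : probability T R) (G : nat -> set (set T))
    (A : nat -> T -> R) : Prop :=
  (exists a : R, \forall w \ae P, A 0%N w = a) /\
  forall t, measurable_wrt (G t) (A t.+1).

Definition nondecreasing_process (d : measure_display) (T : measurableType d)
    (R : realType) (P : probability T R) (A : nat -> T -> R) : Prop :=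
  forall s t, (s <= t)%N -> \forall w \ae P, A s w <= A t w.

Definition tilde_cost (T : Type) (R : realType) (m : nat)
    (g : 'I_m -> nat -> T -> R) (c : 'I_m -> 'I_m -> nat -> T -> R)
    (i j : 'I_m) (t : nat) : T -> R :=
  fun w => g j t w + c i j t w.

(* A strategy (xi_t), t >= -1: initial_mode is xi_{-1}, mode t is xi_t. *)
Record strategy (T : Type) (G : nat -> set (set T)) (m : nat) := Strategy {
  initial_mode : 'I_m ;
  mode : nat -> T -> 'I_m ;
  mode_adapted : forall t j, G t (mode t @^-1` [set j]) }.

(* xi_{t-1} *)
Definition previous_mode (T : Type) (G : nat -> set (set T)) (m : nat)
    (xi : strategy G m) (t : nat) (w : T) : 'I_m :=
  if t is t'.+1 then mode xi t' w else initial_mode xi.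

Definition strategies_from (d : measure_display) (T : measurableType d)
    (R : realType) (P : probability T R) (G : nat -> set (set T)) (m : nat)
    (i : 'I_m) (t : nat) : set (strategy G m) :=
  [set xi | \forall w \ae P, previous_mode xi t w = i].
Arguments strategies_from {d T R} P G {m} i t.

Definition strategy_cost (T : Type) (R : realType) (G : nat -> set (set T))
    (m : nat) (g : 'I_m -> nat -> T -> R)
    (c : 'I_m -> 'I_m -> nat -> T -> R) (xi : strategy G m)
    : nat -> T -> R :=
  fun s w => tilde_cost g c (previous_mode xi s w) (mode xi s w) s w.

(* V is (a version of) the essential infimum of the family S of random
   variables, not to be confused with the library's ess_inf, which is the
   essential infimum of the values of one function. *)
Definition is_essinf_family (d : measure_display) (T : measurableType d)
    (R : realType) (P : probability T R) (S : set (T -> \bar R))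
    (V : T -> \bar R) : Prop :=
  [/\ measurable_fun [set: T] V,
      forall X, S X -> \forall w \ae P, (V w <= X w)%E &
      forall Z : T -> \bar R, measurable_fun [set: T] Z ->
        (forall X, S X -> \forall w \ae P, (Z w <= X w)%E) ->
        \forall w \ae P, (Z w <= V w)%E].

Definition is_value_process (d : measure_display) (T : measurableType d)
    (R : realType) (P : probability T R) (G : nat -> set (set T))
    (rho : nat -> (T -> R) -> (T -> R)) (m : nat)
    (g : 'I_m -> nat -> T -> R) (c : 'I_m -> 'I_m -> nat -> T -> R)
    (V : 'I_m -> nat -> T -> \bar R) : Prop :=
  forall i t, is_essinf_family P
    [set aggregated_risk_infty rho t (strategy_cost g c xi)
      | xi in strategies_from P G i t]
    (V i t).

(* The minimum is taken in \bar R, with value +oo when m = 1. *)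
Definition switching_barrier (T : Type) (R : realType)
    (rho : nat -> (T -> R) -> (T -> R)) (m : nat)
    (g : 'I_m -> nat -> T -> R) (c : 'I_m -> 'I_m -> nat -> T -> R)
    (Y : 'I_m -> nat -> T -> R) (i : 'I_m) (t : nat) (w : T) : \bar R :=
  \big[Order.min/+oo%E]_(j < m | j != i)
    (rho t (fun w' => tilde_cost g c i j t w' + Y j t.+1 w') w)%:E.

Record RBSDE_system (d : measure_display) (T : measurableType d)
    (R : realType) (P : probability T R)
    (rho : nat -> (T -> R) -> (T -> R)) (m : nat)
    (g : 'I_m -> nat -> T -> R) (c : 'I_m -> 'I_m -> nat -> T -> R)
    (Y M A : 'I_m -> nat -> T -> R) : Prop := RBSDESystem {
  RBSDE_dynamics : forall i t u, (t <= u)%N -> \forall w \ae P,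
    Y i t w = Y i u w
      + \sum_(t <= s < u)
          rho s (fun w' => g i s w' + (M i s.+1 w' - M i s w')) w
      - (M i u w - M i t w) - (A i u w - A i t w) ;
  RBSDE_barrier : forall i t, \forall w \ae P,
    ((Y i t w)%:E <= switching_barrier rho g c Y i t w)%E ;
  (* the terms are almost surely nonpositive, so this series converges in
     \bar R *)
  RBSDE_skorokhod : forall i, \forall w \ae P,
    (\sum_(0 <= t <oo)
       (((Y i t w)%:E - switching_barrier rho g c Y i t w)
        * (A i t.+1 w - A i t w)%:E) = 0)%E }.

Record RBSDE_solution (d : measure_display) (T : measurableType d)
    (R : realType) (P : probability T R) (G : nat -> set (set T))
    (rho : nat -> (T -> R) -> (T -> R)) (m : nat)
    (g : 'I_m -> nat -> T -> R) (c : 'I_m -> 'I_m -> nat -> T -> R)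
    (Y M A : 'I_m -> nat -> T -> R) : Prop := RBSDESolution {
  solution_Y : forall i, adapted_Linfty_vanishing P G (Y i) ;
  solution_M : forall i, adapted_Linfty P G (M i) ;
  solution_A : forall i, adapted_Linfty P G (A i) ;
  solution_martingale : forall i, risk_martingale P rho (M i) ;
  solution_predictable : forall i, predictable P G (A i) ;
  solution_nondecreasing : forall i, nondecreasing_process P (A i) ;
  solution_M0 : forall i, \forall w \ae P, M i 0%N w = 0 ;
  solution_A0 : forall i, \forall w \ae P, A i 0%N w = 0 ;
  solution_system : RBSDE_system P rho g c Y M A }.

Definition indistinguishable (d : measure_display) (T : measurableType d)
    (R : realType) (P : probability T R) (m : nat)
    (X X' : 'I_m -> nat -> T -> R) : Prop :=
  \forall w \ae P, forall i t, X i t w = X' i t w.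

(* Main.v *)
(* By translation invariance, a triple (Y, M, A) solves the system exactly when
   Y solves the dynamic programming equation
     Y^i_t = min_j rho_t(g~_{i,j}(t) + Y^j_{t+1}),
   with Delta M_{t+1} = Y_{t+1} - rho_t(Y_{t+1}) and
   Delta A^i_{t+1} = rho_t(g_i(t) + Y^i_{t+1}) - Y^i_t.  The right-hand side is
   nonexpansive in the sup norm, so two solutions vanishing at infinity
   coincide, and the finite-horizon values started from 0 converge because the
   summable bound k makes them Cauchy.  Monotonicity and the locality of rho_t
   on G_t give Y <= cost for every strategy, with equality when each mode
   minimises the dynamic programming equation. *)
Require Import Defs.
From HB Require Import structures.
From mathcomp Require Import all_boot all_order all_algebra.
From mathcomp Require Import all_classical all_reals all_analysis.
From mathcomp Require Import measurable_realfun ess_sup_inf.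
From mathcomp Require Import ring.

Import Order.TTheory GRing.Theory Num.Theory.
Import numFieldNormedType.Exports.

Local Open Scope classical_set_scope.
Local Open Scope ring_scope.

(** The only continuity of [rho t] used here is the sup-norm bound that monotonicity and translation
    by constants give. Every passage to the limit is therefore made with a deterministic error,
    uniform in w (a tail of the series of k, or a bound on a terminal value), which survives any
    number of nested mappings. The equations hold only almost surely, so each argument at a fixed w
    first collects countably many of them (times, horizons, errors 1/(k+1)) on one set of full
    measure. The uncountable family of strategies causes no trouble, because a single strategy
    attains the essential infimum. The dynamic programming minimum includes j = i, whereas the
    barrier omits it. The Skorokhod condition closes this gap: at each time either Delta A vanishes,
    which means that staying in i is optimal, or Y meets the barrier. *)

(** * Limit superior and series in the extended reals *)

Section ExtendedRealSequences.
Set Implicit Arguments.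
Unset Strict Implicit.
Context {R : realType}.
Implicit Types (u : nat -> \bar R) (l : \bar R).

Lemma limn_esup_le u l : (\forall n \near \oo, (u n <= l)%E) ->
  (limn_esup u <= l)%E.
Proof.
move=> [N _ uN]; apply: (@le_trans _ _ (esups u N)).
  rewrite limn_esup_lim; apply: lime_le; first exact: is_cvg_esups.
  exists N => // n /= Nn; exact: nonincreasing_esups.
by apply: ge_ereal_sup => _ [n /= Nn <-]; exact: uN.
Qed.

Lemma limn_esup_ge u l : (\forall n \near \oo, (l <= u n)%E) ->
  (l <= limn_esup u)%E.
Proof.
move=> [N _ uN]; rewrite limn_esup_lim; apply: lime_ge.
  exact: is_cvg_esups.
exists N => // n /= Nn; apply: ereal_sup_ge; exists (u n); last exact: uN.
by exists n => /=.
Qed.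

(** The partial sums are nonincreasing, so the sum is their infimum and lies below each single term.
    This splits the Skorokhod condition into one equation per time. *)
Lemma npeseries_eq0 (u : nat -> \bar R) : (forall n, (u n <= 0)%E) ->
  (\sum_(0 <= n <oo) u n = 0)%E -> forall n, u n = 0%E.
Proof.
move=> u0 sum0 n; apply/eqP; rewrite eq_le u0 /=.
have := @ereal_nonincreasing_cvgn _ (fun n => \sum_(0 <= i < n) u i)%E.
move=> /(_ (lee_sum_npos_natr _ xpredT 0%N (fun n _ _ => u0 n))).
move=> /(cvg_lim (@ereal_hausdorff _)); rewrite sum0 => ->.
apply: (@le_trans _ _ (\sum_(0 <= i < n.+1) u i)%E).
  by apply: ereal_inf_lbound; exists n.+1.
by rewrite big_nat_recr //= geeDr // sume_le0.
Qed.

End ExtendedRealSequences.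

(** * Measurability with respect to a sub-sigma-algebra *)

Section MeasurabilityWrt.
Set Implicit Arguments.
Unset Strict Implicit.
Context {d : measure_display} {T : measurableType d} {R : realType}.
Implicit Types (H : set (set T)) (X Y : T -> R).

(** Measurability of a map into a finite type, in the same form as [mode_adapted]. *)
Definition fibers_in H {I : finType} (f : T -> I) : Prop :=
  forall i, H (f @^-1` [set i]).

Lemma measurable_wrt_cst H (r : R) : measurable_wrt H (fun=> r).
Proof. exact: measurable_cst. Qed.

Lemma measurable_wrtD H X Y : measurable_wrt H X -> measurable_wrt H Y ->
  measurable_wrt H (fun w => X w + Y w).
Proof. exact: measurable_funD. Qed.

Lemma measurable_wrtB H X Y : measurable_wrt H X -> measurable_wrt H Y ->
  measurable_wrt H (fun w => X w - Y w).
Proof. exact: measurable_funB. Qed.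

Lemma measurable_wrt_min H X Y : measurable_wrt H X -> measurable_wrt H Y ->
  measurable_wrt H (fun w => Order.min (X w) (Y w)).
Proof. exact: measurable_minr. Qed.

Lemma measurable_wrt_sub H H' X : H `<=` H' -> measurable_wrt H X ->
  measurable_wrt H' X.
Proof.
by move=> HH' mX _ B mB; apply: (sub_sigma_algebra2 HH'); exact: mX.
Qed.

Lemma measurable_wrtT X :
  measurable_wrt (@measurable d T) X <-> measurable_fun [set: T] X.
Proof.
have E : <<s @measurable d T >> = @measurable d T.
  by apply: sigma_algebra_id; exact: sigma_algebra_measurable.
by split=> mX _ B mB; have := mX measurableT B mB; rewrite /measurable /= E.
Qed.

Lemma fibers_in_sub H H' {I : finType} (f : T -> I) :
  H `<=` H' -> fibers_in H f -> fibers_in H' f.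
Proof. by move=> HH' hf i; exact/HH'/hf. Qed.

Section SigmaAlgebra.
Variable H : set (set T).
Hypothesis sH : sigma_algebra [set: T] H.

Let inH (A : set T) : H A <-> measurable (A : set (g_sigma_algebraType H)).
Proof. by rewrite /measurable /= (sigma_algebra_id sH). Qed.

Lemma fibers_in_preimage {I : finType} (f : T -> I) (S : set I) :
  fibers_in H f -> H (f @^-1` S).
Proof.
move=> fH; apply/inH.
rewrite (_ : f @^-1` S = \bigcup_(i in S) (f @^-1` [set i])).
  by apply: fin_bigcup_measurable => // i _; apply/inH; exact: fH.
by apply/seteqP; split=> w /=; [exists (f w)|case=> i Si /= ->].
Qed.

Lemma fibers_in_comp {I J : finType} (h : I -> J) (f : T -> I) :
  fibers_in H f -> fibers_in H (h \o f).
Proof. by move=> fH j; rewrite comp_preimage; exact: fibers_in_preimage. Qed.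

Lemma fibers_in_pair {I J : finType} (f : T -> I) (h : T -> J) :
  fibers_in H f -> fibers_in H h -> fibers_in H (fun w => (f w, h w)).
Proof.
move=> fH hH [i j]; apply/inH.
rewrite (_ : _ @^-1` _ = f @^-1` [set i] `&` h @^-1` [set j]).
  by apply: measurableI; apply/inH.
by apply/seteqP; split=> w /= => [[-> ->]|[-> ->]].
Qed.

Lemma fibers_in_ffun {I J : finType} (f : I -> T -> J) :
  (forall i, fibers_in H (f i)) ->
  fibers_in H (fun w => [ffun i => f i w]).
Proof.
move=> fH p; apply/inH.
rewrite (_ : _ @^-1` _ = \bigcap_(i in [set: I]) (f i @^-1` [set p i])).
  by apply: fin_bigcap_measurable => // i _; apply/inH; exact: fH.
apply/seteqP; split=> w /= => [pE i _ /=|pE].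
  by rewrite -pE ffunE.
by apply/ffunP => i; rewrite ffunE; exact: pE.
Qed.

Lemma fibers_in_cst {I : finType} (i : I) : fibers_in H (fun=> i).
Proof.
move=> j; apply/inH; rewrite (_ : _ @^-1` _ = [set w | i = j]) //.
by have [->|/eqP ij] := eqVneq i j;
  [rewrite (_ : [set _ | _] = setT)|rewrite (_ : [set _ | _] = set0)] => //;
  apply/seteqP; split.
Qed.

Lemma fibers_in_le X Y : measurable_wrt H X -> measurable_wrt H Y ->
  fibers_in H (fun w => X w <= Y w).
Proof.
move=> mX mY b; apply/inH.
have := measurable_fun_ler mX mY; move=> /(_ measurableT [set b]).
by rewrite setTI; apply.
Qed.

(** Needed for quantities indexed by a random mode: the preimage splits over the finitely many
    values of f. *)
Lemma measurable_wrt_glue {I : finType} (f : T -> I) (X : I -> T -> R) :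
  fibers_in H f -> (forall i, measurable_wrt H (X i)) ->
  measurable_wrt H (fun w => X (f w) w).
Proof.
move=> fH mX _ B mB; rewrite setTI.
rewrite (_ : _ @^-1` _ =
  \bigcup_(i in [set: I]) (f @^-1` [set i] `&` X i @^-1` B)).
  apply: fin_bigcup_measurable => // i _; apply: measurableI.
    exact/inH.
  by rewrite -[_ @^-1` _]setTI; exact: mX.
by apply/seteqP; split=> w /=; [exists (f w)|case=> i _ [/= <-]].
Qed.

End SigmaAlgebra.
End MeasurabilityWrt.

(** * Essentially bounded variables and vanishing sequences *)

Section EssentiallyBounded.
Set Implicit Arguments.
Unset Strict Implicit.
Context {d : measure_display} {T : measurableType d} {R : realType}.
Variable P : probability T R.
Implicit Types (H : set (set T)) (X Y : T -> R).

Lemma ae_forall_fin {I : finType} (Q : I -> T -> Prop) :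
  (forall i, \forall w \ae P, Q i w) -> \forall w \ae P, forall i, Q i w.
Proof. exact: filter_forall. Qed.

Lemma ess_norm_leP X (r : R) :
  (ess_norm P X <= r%:E)%E <-> \forall w \ae P, `|X w| <= r.
Proof.
split=> [/ess_supP|] h; first by apply: filterS h => w; rewrite lee_fin.
by apply/ess_supP; apply: filterS h => w; rewrite lee_fin.
Qed.

Lemma LinftyP H X : Linfty P H X <->
  measurable_wrt H X /\ exists r, \forall w \ae P, `|X w| <= r.
Proof.
split=> -[mX bX]; split=> //.
  case E : (ess_norm P X) bX => [r| |] // _.
    by exists r; apply/ess_norm_leP; rewrite E.
  by exists 0; apply/ess_norm_leP; rewrite E leNye.
by case: bX => r /ess_norm_leP /le_lt_trans; apply; rewrite ltry.
Qed.

Lemma Linfty_cst H (r : R) : Linfty P H (fun=> r).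
Proof.
by apply/LinftyP; split; [exact: measurable_wrt_cst|exists `|r|; exact: nearW].
Qed.

Lemma LinftyD H X Y : Linfty P H X -> Linfty P H Y ->
  Linfty P H (fun w => X w + Y w).
Proof.
move=> /LinftyP[mX [r hr]] /LinftyP[mY [s hs]]; apply/LinftyP.
split; first exact: measurable_wrtD.
exists (r + s); apply: filterS2 hr hs => w hr hs.
by rewrite (le_trans (ler_normD _ _)) // lerD.
Qed.

Lemma LinftyB H X Y : Linfty P H X -> Linfty P H Y ->
  Linfty P H (fun w => X w - Y w).
Proof.
move=> /LinftyP[mX [r hr]] /LinftyP[mY [s hs]]; apply/LinftyP.
split; first exact: measurable_wrtB.
exists (r + s); apply: filterS2 hr hs => w hr hs.
by rewrite (le_trans (ler_normB _ _)) // lerD.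
Qed.

Lemma Linfty_min H X Y : Linfty P H X -> Linfty P H Y ->
  Linfty P H (fun w => Order.min (X w) (Y w)).
Proof.
move=> /LinftyP[mX [r hr]] /LinftyP[mY [s hs]]; apply/LinftyP.
split; first exact: measurable_wrt_min.
exists (Order.max r s); apply: filterS2 hr hs => w hr hs.
by rewrite le_max; case: (leP (X w) (Y w)); rewrite ?hr ?hs ?orbT.
Qed.

Lemma Linfty_sum_nat H t (X : nat -> T -> R) :
  (forall s, (s < t)%N -> Linfty P H (X s)) ->
  Linfty P H (fun w => \sum_(0 <= s < t) X s w).
Proof.
elim: t => [|t IH] hX.
  by under eq_fun do rewrite big_geq //; exact: Linfty_cst.
under eq_fun do rewrite big_nat_recr //=.
apply: LinftyD; last exact: hX.
by apply: IH => s st; apply: hX; exact: ltnW.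
Qed.

Lemma Linfty_bigmin H {I : Type} (r : seq I) (X0 : T -> R) (X : I -> T -> R) :
  Linfty P H X0 -> (forall i, Linfty P H (X i)) ->
  Linfty P H (fun w => \big[Order.min/X0 w]_(i <- r) X i w).
Proof.
move=> hX0 hX; elim: r => [|i r IH].
  by under eq_fun do rewrite big_nil.
by under eq_fun do rewrite big_cons; exact: Linfty_min.
Qed.

Lemma Linfty_sub H H' X : H `<=` H' -> Linfty P H X -> Linfty P H' X.
Proof. by move=> HH' [mX bX]; split => //; exact: measurable_wrt_sub mX. Qed.

Lemma Linfty_glue H {I : finType} (f : T -> I) (X : I -> T -> R) :
  sigma_algebra [set: T] H -> fibers_in H f ->
  (forall i, Linfty P H (X i)) -> Linfty P H (fun w => X (f w) w).
Proof.
move=> sH fH hX; apply/LinftyP; split.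
  by apply: measurable_wrt_glue => // i; case: (hX i).
have /choice[r hr] : forall i, exists r, \forall w \ae P, `|X i w| <= r.
  by move=> i; have /LinftyP[] := hX i.
(* The sum of the absolute bounds dominates each [r i], whichever index [f w] selects. *)
exists (\sum_i `|r i|); apply: filterS (ae_forall_fin hr) => w /(_ (f w)) h.
rewrite (le_trans h) // (le_trans (ler_norm _)) // (bigD1 (f w)) //=.
by rewrite lerDl sumr_ge0.
Qed.

Lemma vanishingP (X : nat -> T -> R) :
  (ess_norm P (X s) @[s --> \oo] --> (0 : \bar R)) <->
  forall e : R, 0 < e -> \forall s \near \oo, \forall w \ae P, `|X s w| <= e.
Proof.
have e0 s : (0 <= ess_norm P (X s))%E.
  apply: ess_sup_gee => /=.
    (* On a space of mass 0 the essential supremum would be -oo; total mass 1 rules this out. *)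
    by rewrite [X in (_ < X)%E](@probability_setT _ _ _ P) lte01.
  by apply: nearW => w; rewrite lee_fin.
split=> [/fine_cvgP[hfin /cvgr0Pnorm_le h] e e_gt0|h].
  apply: filterS2 hfin (h e e_gt0) => s hfin hs; apply/ess_norm_leP.
  by rewrite -(fineK hfin) lee_fin (le_trans (ler_norm _)).
apply/fine_cvgP; split.
  apply: filterS (h 1 ltr01) => s /ess_norm_leP hs.
  by rewrite ge0_fin_numE // (le_lt_trans hs) // ltry.
apply/cvgr0Pnorm_le => e e_gt0.
apply: filterS (h e e_gt0) => s /ess_norm_leP hs.
rewrite ger0_norm ?fine_ge0 // -lee_fin fineK //.
by rewrite ge0_fin_numE // (le_lt_trans hs) // ltry.
Qed.

End EssentiallyBounded.

(** * Consequences of the axioms of a conditional risk mapping *)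

Section RiskMapping.
Set Implicit Arguments.
Unset Strict Implicit.
Context {d : measure_display} {T : measurableType d} {R : realType}.
Variables (P : probability T R) (G : nat -> set (set T)).
Hypothesis hG : filtration G.
Variable rho : nat -> (T -> R) -> (T -> R).
Hypothesis hrho : conditional_risk_mapping P G rho.
Implicit Types (W Z X D : T -> R).

Lemma Linfty_F t X : Linfty P (G t) X -> LinftyF P X.
Proof. by apply: Linfty_sub; exact: (filtration_sub hG). Qed.

Lemma Linfty_le s t X : (s <= t)%N -> Linfty P (G s) X -> Linfty P (G t) X.
Proof. by move=> st; apply: Linfty_sub; exact: (filtration_le hG). Qed.

Lemma risk_LinftyF t W : LinftyF P W -> LinftyF P (rho t W).
Proof. by move=> hW; apply: (@Linfty_F t); exact: (risk_Linfty hrho). Qed.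

(** Monotonicity and translation invariance combined. A constant D gives the Lipschitz bound and the
    error estimates below; D supported off an event of [G t] gives locality. *)
Lemma risk_shift t W Z D : LinftyF P W -> LinftyF P Z -> Linfty P (G t) D ->
  (\forall w \ae P, W w <= D w + Z w) ->
  \forall w \ae P, rho t W w <= D w + rho t Z w.
Proof.
move=> hW hZ hD WZ.
have hDZ : LinftyF P (fun w => D w + Z w) by apply: LinftyD => //; apply: Linfty_F hD.
have h := risk_monotone hrho t hW hDZ WZ.
by apply: filterS2 h (risk_translation hrho hZ hD) => w + <-.
Qed.

Lemma risk_ext t W Z : LinftyF P W -> LinftyF P Z ->
  (\forall w \ae P, W w = Z w) -> \forall w \ae P, rho t W w = rho t Z w.
Proof.
move=> hW hZ WZ.
have h1 : \forall w \ae P, rho t W w <= rho t Z w.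
  by apply: (risk_monotone hrho) => //; apply: filterS WZ => w ->.
have h2 : \forall w \ae P, rho t Z w <= rho t W w.
  by apply: (risk_monotone hrho) => //; apply: filterS WZ => w ->.
by apply: filterS2 h1 h2 => w h1 h2; apply/eqP; rewrite eq_le h1.
Qed.

Lemma risk_lipschitz t W Z (e : R) : LinftyF P W -> LinftyF P Z ->
  (\forall w \ae P, `|W w - Z w| <= e) ->
  \forall w \ae P, `|rho t W w - rho t Z w| <= e.
Proof.
move=> hW hZ WZ.
have h1 : \forall w \ae P, rho t W w <= e + rho t Z w.
  apply: (@risk_shift t W Z (fun=> e)) => //; first exact: Linfty_cst.
  by apply: filterS WZ => w; rewrite ler_distl => /andP[_]; rewrite addrC.
have h2 : \forall w \ae P, rho t Z w <= e + rho t W w.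
  apply: (@risk_shift t Z W (fun=> e)) => //; first exact: Linfty_cst.
  by apply: filterS WZ => w; rewrite distrC ler_distl => /andP[_]; rewrite addrC.
apply: filterS2 h1 h2 => w h1 h2.
by rewrite ler_distl lerBlDl h2 addrC h1.
Qed.

Lemma risk_id t Z : Linfty P (G t) Z -> \forall w \ae P, rho t Z w = Z w.
Proof.
move=> hZ; have h0 : LinftyF P (fun _ : T => 0 : R) by exact: Linfty_cst.
have := risk_translation hrho h0 hZ.
under [X in rho t X]eq_fun do rewrite addr0.
by move=> h; apply: filterS2 h (risk_normalised hrho t) => w -> ->; rewrite addr0.
Qed.

(* A bound C on |W - Z| gives W <= Z + C 1_{f <> i}; monotonicity and
   translation invariance turn this into rho(W) <= rho(Z) + C 1_{f <> i}. *)
Lemma risk_local_le t {I : finType} (f : T -> I) (i : I) W Z :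
  fibers_in (G t) f -> LinftyF P W -> LinftyF P Z ->
  (\forall w \ae P, f w = i -> W w <= Z w) ->
  \forall w \ae P, f w = i -> rho t W w <= rho t Z w.
Proof.
move=> hf hW hZ WZ.
have /LinftyP[_ [C hC]] := LinftyB hW hZ.
pose D w := C *+ (f w != i).
have hD : Linfty P (G t) D.
  apply: (@Linfty_glue _ _ _ P (G t) _ f (fun j _ => C *+ (j != i))) => //.
    exact: (filtration_sigma_algebra hG).
  by move=> j; exact: Linfty_cst.
have h : \forall w \ae P, rho t W w <= D w + rho t Z w.
  apply: risk_shift => //; apply: filterS2 hC WZ => w hC WZ.
  rewrite /D; case: eqVneq => [/WZ|_]; first by rewrite add0r.
  by rewrite mulr1n -lerBlDr (le_trans (ler_norm _)).
by apply: filterS h => w + fw; rewrite /D fw eqxx add0r.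
Qed.

Lemma risk_local t {I : finType} (f : T -> I) (i : I) W Z :
  fibers_in (G t) f -> LinftyF P W -> LinftyF P Z ->
  (\forall w \ae P, f w = i -> W w = Z w) ->
  \forall w \ae P, f w = i -> rho t W w = rho t Z w.
Proof.
move=> hf hW hZ WZ.
have h1 : \forall w \ae P, f w = i -> rho t W w <= rho t Z w.
  by apply: risk_local_le => //; apply: filterS WZ => w h /h ->.
have h2 : \forall w \ae P, f w = i -> rho t Z w <= rho t W w.
  by apply: risk_local_le => //; apply: filterS WZ => w h /h ->.
apply: filterS2 h1 h2 => w h1 h2 fw.
by apply/eqP; rewrite eq_le h1 // h2.
Qed.

Lemma aggregate_steps_Linfty n s (W : nat -> T -> R) :
  (forall u, LinftyF P (W u)) -> Linfty P (G s) (aggregate_steps rho n s W).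
Proof.
move=> hW; elim: n s => [|n IH] s /=; apply: (risk_Linfty hrho) => //.
by apply: LinftyD; [exact: hW|exact: (Linfty_F (IH _))].
Qed.

(** * Comparison of one-step inequalities with the aggregated risk *)

Section Verification.
Variables (W U : nat -> T -> R).
Hypotheses (hW : forall u, LinftyF P (W u)) (hU : forall u, LinftyF P (U u)).

Let hWU u : LinftyF P (fun w => W u w + U u.+1 w).
Proof. by apply: LinftyD; [exact: hW|exact: hU]. Qed.

(** Unrolling the one-step inequality from s to s + n leaves the terminal value [U (s + n).+1]
    inside the innermost mapping. Dropping it there costs at most e, and translation invariance
    moves this constant outwards through the nested mappings without enlarging it. *)
Lemma le_aggregate_steps n s (e : R) :
  (forall u, (s <= u)%N ->
     \forall w \ae P, U u w <= rho u (fun w' => W u w' + U u.+1 w') w) ->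
  (\forall w \ae P, `|U (s + n).+1 w| <= e) ->
  \forall w \ae P, U s w <= e + aggregate_steps rho n s W w.
Proof.
elim: n s => [|n IH] s hrec hn /=.
  have h : \forall w \ae P,
      rho s (fun w' => W s w' + U s.+1 w') w <= e + rho s (W s) w.
    apply: (@risk_shift s _ _ (fun=> e)) => //; first exact: Linfty_cst.
    apply: filterS hn => w; rewrite addn0 addrC lerD2r.
    exact: le_trans (ler_norm _).
  by apply: filterS2 (hrec _ (leqnn s)) h => w; exact: le_trans.
have h : \forall w \ae P, rho s (fun w' => W s w' + U s.+1 w') w <=
    e + rho s (fun w => W s w + aggregate_steps rho n s.+1 W w) w.
  apply: (@risk_shift s _ _ (fun=> e)) => //; last 2 first.
  - exact: Linfty_cst.
  - rewrite -addSnnS in hn.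
    apply: filterS (IH _ (fun u su => hrec u (ltnW su)) hn) => w h.
    by rewrite addrCA lerD2l.
  by apply: LinftyD; [exact: hW|exact: (Linfty_F (aggregate_steps_Linfty _ _ hW))].
by apply: filterS2 (hrec _ (leqnn s)) h => w; exact: le_trans.
Qed.

Lemma ge_aggregate_steps n s (e : R) :
  (forall u, (s <= u)%N ->
     \forall w \ae P, rho u (fun w' => W u w' + U u.+1 w') w <= U u w) ->
  (\forall w \ae P, `|U (s + n).+1 w| <= e) ->
  \forall w \ae P, aggregate_steps rho n s W w <= e + U s w.
Proof.
elim: n s => [|n IH] s hrec hn /=.
  have h : \forall w \ae P,
      rho s (W s) w <= e + rho s (fun w' => W s w' + U s.+1 w') w.
    apply: (@risk_shift s _ _ (fun=> e)) => //; first exact: Linfty_cst.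
    apply: filterS hn => w; rewrite addn0 addrCA lerDl -lerBlDr sub0r lerNl.
    by rewrite ler_norml => /andP[].
  by apply: filterS2 h (hrec _ (leqnn s)) => w h hr; rewrite (le_trans h) ?lerD2l.
have h : \forall w \ae P,
    rho s (fun w => W s w + aggregate_steps rho n s.+1 W w) w <=
    e + rho s (fun w' => W s w' + U s.+1 w') w.
  apply: (@risk_shift s _ _ (fun=> e)) => //; last 2 first.
  - exact: Linfty_cst.
  - rewrite -addSnnS in hn.
    apply: filterS (IH _ (fun u su => hrec u (ltnW su)) hn) => w h.
    by rewrite addrCA lerD2l.
  by apply: LinftyD; [exact: hW|exact: (Linfty_F (aggregate_steps_Linfty _ _ hW))].
by apply: filterS2 h (hrec _ (leqnn s)) => w h hr; rewrite (le_trans h) ?lerD2l.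
Qed.

Hypothesis U_vanishing :
  forall e : R, 0 < e -> \forall u \near \oo, \forall w \ae P, `|U u w| <= e.

(** Restricting the errors to 1/(k+1) leaves countably many conditions, hence one null set. The rank
    from which Q holds depends on k but not on w. *)
Let U_vanishing_seq s (Q : R -> nat -> T -> Prop) :
  (forall e n, (\forall w \ae P, `|U (s + n).+1 w| <= e) ->
     \forall w \ae P, Q e n w) ->
  \forall w \ae P, forall k, \forall n \near \oo, Q k.+1%:R^-1 n w.
Proof.
move=> hQ; apply/ae_foralln => k.
have [|N _ hN] := U_vanishing (e := k.+1%:R^-1); first by rewrite invr_gt0.
suff : \forall w \ae P, forall n, (N <= n)%N -> Q k.+1%:R^-1 n w.
  by apply: filterS => w h; exists N => // n /= ?; exact: h.
apply/ae_foralln => n; have [Nn|nN] := leqP N n; last exact: nearW.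
have := hQ k.+1%:R^-1 n; move=> /(_ _)/filterS; apply => //.
by apply: hN => /=; rewrite leqW // (leq_trans Nn) // leq_addl.
Qed.

(** The finite-horizon bound holds for all large t up to 1/(k+1), and a bound that holds eventually
    passes to the limit superior. *)
Lemma le_aggregated_risk_infty s :
  (forall u, (s <= u)%N ->
     \forall w \ae P, U u w <= rho u (fun w' => W u w' + U u.+1 w') w) ->
  \forall w \ae P, ((U s w)%:E <= aggregated_risk_infty rho s W w)%E.
Proof.
move=> hrec.
have := U_vanishing_seq (fun e n => @le_aggregate_steps n s e hrec).
apply: filterS => w hw; apply/lee_addgt0Pr => e e_gt0.
have [k _ /(_ k (leqnn _)) /= hk] := near_infty_natSinv_lt (PosNum e_gt0).
have [N _ hN] := hw k.
rewrite -leeBlDr //; apply: limn_esup_ge.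
exists (s + N)%N => // t /= st; rewrite -EFinB lee_fin.
have hst : (s <= t)%N by rewrite (leq_trans _ st) // leq_addr.
have /= h := hN (t - s)%N; rewrite lerBlDl (le_trans (h _)) ?lerD2r ?ltW //.
by rewrite leq_subRL.
Qed.

Lemma ge_aggregated_risk_infty s :
  (forall u, (s <= u)%N ->
     \forall w \ae P, rho u (fun w' => W u w' + U u.+1 w') w <= U u w) ->
  \forall w \ae P, (aggregated_risk_infty rho s W w <= (U s w)%:E)%E.
Proof.
move=> hrec.
have := U_vanishing_seq (fun e n => @ge_aggregate_steps n s e hrec).
apply: filterS => w hw; apply/lee_addgt0Pr => e e_gt0.
have [k _ /(_ k (leqnn _)) /= hk] := near_infty_natSinv_lt (PosNum e_gt0).
have [N _ hN] := hw k.
apply: limn_esup_le.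
exists (s + N)%N => // t /= st; rewrite -EFinD lee_fin.
have hst : (s <= t)%N by rewrite (leq_trans _ st) // leq_addr.
have /= h := hN (t - s)%N; rewrite addrC (le_trans (h _)) ?lerD2r ?ltW //.
by rewrite leq_subRL.
Qed.

End Verification.
End RiskMapping.

(** * The dynamic programming operator *)

Section Bellman.
Set Implicit Arguments.
Unset Strict Implicit.
Context {d : measure_display} {T : measurableType d} {R : realType}.
Variables (P : probability T R) (G : nat -> set (set T)).
Hypothesis hG : filtration G.
Variable rho : nat -> (T -> R) -> (T -> R).
Hypothesis hrho : conditional_risk_mapping P G rho.
Variables (m : nat) (g : 'I_m -> nat -> T -> R).
Variable (c : 'I_m -> 'I_m -> nat -> T -> R).
Hypothesis hg : forall i t, LinftyF P (g i t).
Hypothesis hc : forall i j t, LinftyF P (c i j t).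
Implicit Types Y : 'I_m -> nat -> T -> R.

Definition continuation Y (i j : 'I_m) (t : nat) : T -> R :=
  rho t (fun w => tilde_cost g c i j t w + Y j t.+1 w).

(** Starting the fold at the term j = i keeps the minimum real-valued. Staying in i is among the
    choices here, unlike in [switching_barrier]. *)
Definition bellman Y (i : 'I_m) (t : nat) (w : T) : R :=
  \big[Order.min/continuation Y i i t w]_(j < m) continuation Y i j t w.

Lemma tilde_cost_LinftyF i j t : LinftyF P (tilde_cost g c i j t).
Proof. by apply: LinftyD; [exact: hg|exact: hc]. Qed.

Lemma tilde_costD_LinftyF Y i j t : LinftyF P (Y j t.+1) ->
  LinftyF P (fun w => tilde_cost g c i j t w + Y j t.+1 w).
Proof. by move=> hY; apply: LinftyD => //; exact: tilde_cost_LinftyF. Qed.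

Lemma continuation_Linfty Y i j t : LinftyF P (Y j t.+1) ->
  Linfty P (G t) (continuation Y i j t).
Proof. by move=> hY; apply: (risk_Linfty hrho); exact: tilde_costD_LinftyF. Qed.

Lemma bellman_Linfty Y i t : (forall j, LinftyF P (Y j t.+1)) ->
  Linfty P (G t) (bellman Y i t).
Proof.
by move=> hY; apply: Linfty_bigmin => [|j]; exact: continuation_Linfty.
Qed.

Lemma bellman_le Y i j t w : bellman Y i t w <= continuation Y i j t w.
Proof. exact: bigmin_le. Qed.

Lemma bellman_attained Y i t w :
  exists j, bellman Y i t w = continuation Y i j t w.
Proof.
case: (@arg_minP _ _ _ i xpredT (fun j => continuation Y i j t w)) => // j _ hj.
exists j; apply/eqP; rewrite eq_le bellman_le /=.
by apply: le_bigmin => [|k _]; exact: hj.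
Qed.

(** Separates staying from switching, the two alternatives of the Skorokhod condition. The equation
    lives in \bar R because the barrier is +oo when m = 1. *)
Lemma bellman_barrierE Y i t w : (bellman Y i t w)%:E =
  Order.min (continuation Y i i t w)%:E (switching_barrier rho g c Y i t w).
Proof.
apply/eqP; rewrite eq_le; apply/andP; split.
  rewrite le_min lee_fin bellman_le /=; apply: le_bigmin => [|j _].
    exact: leey.
  by rewrite lee_fin bellman_le.
have [j ->] := bellman_attained Y i t w.
have [->|ji] := eqVneq j i; first by rewrite ge_min lexx.
by rewrite ge_min; apply/orP; right; exact: bigmin_le_cond.
Qed.

(** Each continuation value moves by at most e; evaluating either minimum at the minimiser of the
    other gives the same bound for the minima. *)
Lemma bellman_lipschitz Y Y' i t (e : R) :
  (forall j, LinftyF P (Y j t.+1)) -> (forall j, LinftyF P (Y' j t.+1)) ->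
  (forall j, \forall w \ae P, `|Y j t.+1 w - Y' j t.+1 w| <= e) ->
  \forall w \ae P, `|bellman Y i t w - bellman Y' i t w| <= e.
Proof.
move=> hY hY' YY'.
have h j : \forall w \ae P,
    `|continuation Y i j t w - continuation Y' i j t w| <= e.
  apply: (risk_lipschitz hG hrho); [exact: tilde_costD_LinftyF..|].
  by apply: filterS (YY' j) => w; rewrite opprD addrACA subrr add0r.
apply: filterS (ae_forall_fin h) => w hw.
have [j hj] := bellman_attained Y i t w.
have [j' hj'] := bellman_attained Y' i t w.
rewrite ler_distl; apply/andP; split.
  rewrite hj (le_trans _ (_ : continuation Y' i j t w - e <= _)) //.
    by rewrite lerB // bellman_le.
  by move: (hw j); rewrite ler_distl => /andP[].
rewrite hj' (le_trans (bellman_le _ _ j' _ _)) //.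
by move: (hw j'); rewrite ler_distl => /andP[].
Qed.

(** * Uniqueness of the vanishing fixed point *)

Section Uniqueness.
Variables (Y Y' : 'I_m -> nat -> T -> R).
Hypotheses (hY : forall i t, LinftyF P (Y i t))
  (hY' : forall i t, LinftyF P (Y' i t)).
Hypothesis YE : forall i t, \forall w \ae P, Y i t w = bellman Y i t w.
Hypothesis Y'E : forall i t, \forall w \ae P, Y' i t w = bellman Y' i t w.

(** The bound travels back from t + n to t undamped. There is no contraction factor, so smallness
    has to come from the behaviour at infinity. *)
Lemma bellman_fixpoint_dist n t (e : R) :
  (forall i, \forall w \ae P, `|Y i (t + n)%N w - Y' i (t + n)%N w| <= e) ->
  forall i, \forall w \ae P, `|Y i t w - Y' i t w| <= e.
Proof.
elim: n t => [|n IH] t; first by rewrite addn0.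
rewrite -addSnnS => /IH h i.
have := @bellman_lipschitz Y Y' i t e (fun j => hY j _) (fun j => hY' j _) h.
by apply: filterS3 (YE i t) (Y'E i t) => w -> ->.
Qed.

Lemma bellman_fixpoint_unique :
  (forall i, ess_norm P (Y i s) @[s --> \oo] --> (0 : \bar R)) ->
  (forall i, ess_norm P (Y' i s) @[s --> \oo] --> (0 : \bar R)) ->
  forall i t, \forall w \ae P, Y i t w = Y' i t w.
Proof.
move=> Y0 Y'0 i t.
have h k : \forall w \ae P, `|Y i t w - Y' i t w| <= k.+1%:R^-1.
  have e0 : 0 < k.+1%:R^-1 / 2 :> R by rewrite divr_gt0 // invr_gt0.
  have hn j : \forall s \near \oo,
      \forall w \ae P, `|Y j s w - Y' j s w| <= k.+1%:R^-1.
    have /vanishingP/(_ _ e0) h1 := Y0 j; have /vanishingP/(_ _ e0) h2 := Y'0 j.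
    apply: filterS2 h1 h2 => s h1 h2; apply: filterS2 h1 h2 => w h1 h2.
    by rewrite (le_trans (ler_normB _ _)) // (splitr k.+1%:R^-1) lerD.
  have [N _ hN] := filter_forall _ hn.
  apply: (bellman_fixpoint_dist (n := N)) => j.
  by apply: hN => /=; rewrite leq_addl.
have := ae_foralln h; apply: filterS => w hw; apply/eqP.
rewrite -subr_eq0 -normr_eq0 eq_le normr_ge0 andbT.
apply/ler_addgt0Pr => e e_gt0; rewrite add0r.
have [k _ /(_ k (leqnn _)) /= hk] := near_infty_natSinv_lt (PosNum e_gt0).
exact: le_trans (hw k) (ltW hk).
Qed.

End Uniqueness.

(** * Construction of the fixed point *)

Section Existence.
Variable k : nat -> R.
Hypotheses (k_ge0 : forall t, 0 <= k t) (k_cvg : cvgn (series k)).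
Hypothesis tilde_le :
  forall t i j, \forall w \ae P, `|tilde_cost g c i j t w| <= k t.

(* approx n i t is the value at time t of the problem with horizon t + n. *)
Definition approx (n : nat) : 'I_m -> nat -> T -> R :=
  iter n bellman (fun _ _ _ => 0).

Lemma approx_Linfty n i t : Linfty P (G t) (approx n i t).
Proof.
elim: n i t => [|n IH] i t; first exact: Linfty_cst.
by apply: bellman_Linfty => j; exact: (Linfty_F hG (IH _ _)).
Qed.

Lemma approx_LinftyF n i t : LinftyF P (approx n i t).
Proof. exact: (Linfty_F hG (approx_Linfty _ _ _)). Qed.

(** The two horizons differ by a single stage, at time t + n. For n = 0 that stage is within [k t]
    of [rho t] at 0, which is 0; the operator carries the difference back without enlarging it. *)
Lemma approxS_dist n i t :
  \forall w \ae P, `|approx n.+1 i t w - approx n i t w| <= k (t + n)%N.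
Proof.
elim: n i t => [|n IH] i t; last first.
  rewrite -addSnnS; apply: (@bellman_lipschitz (approx n.+1) (approx n)) => j.
  - exact: approx_LinftyF.
  - exact: approx_LinftyF.
  - exact: IH.
have h j : \forall w \ae P, `|continuation (approx 0) i j t w| <= k t.
  have h0 : LinftyF P (fun _ : T => 0 : R) by exact: Linfty_cst.
  have : \forall w \ae P,
      `|continuation (approx 0) i j t w - rho t (fun=> 0) w| <= k t.
    apply: (risk_lipschitz hG hrho) => //; first exact: tilde_costD_LinftyF.
    by apply: filterS (tilde_le t i j) => w; rewrite addr0 subr0.
  by apply: filterS2 (risk_normalised hrho t) => w ->; rewrite subr0.
apply: filterS (ae_forall_fin h) => w hw; rewrite addn0 subr0 /=.
by have [j ->] := bellman_attained (approx 0) i t w.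
Qed.

(** The right-hand side is the tail of k from index t + n on, obtained by telescoping
    [approxS_dist]. *)
Lemma approx_dist i t : \forall w \ae P, forall n p, (n <= p)%N ->
  `|approx p i t w - approx n i t w| <= limn (series k) - series k (t + n)%N.
Proof.
have /ae_foralln := fun n => approxS_dist n i t.
apply: filterS => w hw n p np.
have S_nd : nondecreasing_seq (series k).
  by apply/nondecreasing_seqP => q; rewrite seriesSr lerDl.
apply: (@le_trans _ _ (series k (t + p)%N - series k (t + n)%N)); last first.
  by rewrite lerD2r nondecreasing_cvgn_le.
rewrite -(subnKC np); elim: (p - n)%N => [|q IH].
  by rewrite addn0 !subrr normr0.
rewrite !addnS (le_trans (ler_distD (approx (n + q) i t w) _ _)) //.
by rewrite seriesS -addrA lerD.
Qed.

(** Convergence holds only almost surely and [G t] may lack null sets. A limit superior followed by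
    [fine] is defined and [G t]-measurable at every w; infinite values, sent to 0, occur only on a
    null set. *)
Definition value_limit (i : 'I_m) (t : nat) (w : T) : R :=
  fine (limn_esup (fun n => (approx n i t w)%:E)).

Lemma value_limit_dist n i t : \forall w \ae P,
  `|value_limit i t w - approx n i t w| <= limn (series k) - series k (t + n)%N.
Proof.
apply: filterS (approx_dist i t) => w hw.
set a := approx n i t w; set e := limn _ - _.
have h : ((a - e)%R%:E <= limn_esup (fun p => (approx p i t w)%:E) <=
    (a + e)%R%:E)%E.
  apply/andP; split; [apply: limn_esup_ge|apply: limn_esup_le];
    by exists n => // p /= np; move: (hw _ _ np);
       rewrite lee_fin ler_distl => /andP[].
rewrite ler_distl /value_limit.
by case: (limn_esup _) h => [r| |]; rewrite ?lee_fin //= andbF.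
Qed.

Lemma value_limit_Linfty i t : Linfty P (G t) (value_limit i t).
Proof.
apply/LinftyP; split; last first.
  exists (limn (series k) - series k (t + 0)%N).
  by apply: filterS (value_limit_dist 0 i t) => w /=; rewrite subr0.
apply: measurableT_comp; first exact: fine_measurable.
apply: measurable_fun_limn_esup => n.
apply: measurableT_comp; first exact: EFin_measurable.
by case: (approx_Linfty n i t).
Qed.

Lemma tail_vanishing (e : R) : 0 < e ->
  \forall n \near \oo, limn (series k) - series k n <= e.
Proof.
move=> e0; have /cvgrPdist_le/(_ e e0) := k_cvg.
by apply: filterS => n; exact: le_trans (ler_norm _).
Qed.

Lemma value_limit_vanishing i : adapted_Linfty_vanishing P G (value_limit i).
Proof.
split=> [t|]; first exact: value_limit_Linfty.
apply/vanishingP => e /tail_vanishing; apply: filterS => s hs.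
apply: filterS (value_limit_dist 0 i s) => w /=; rewrite subr0 addn0 => h.
exact: le_trans hs.
Qed.

Lemma value_limit_bellman i t :
  \forall w \ae P, value_limit i t w = bellman value_limit i t w.
Proof.
(* [approx n.+1] at t and [approx n] at t + 1 have the same horizon t + 1 + n, hence the same tail
   as error. *)
pose e n := limn (series k) - series k (t.+1 + n)%N.
have h n : \forall w \ae P, `|value_limit i t w - bellman value_limit i t w| <= e n + e n.
  have h1 := value_limit_dist n.+1 i t; rewrite -addSnnS in h1.
  have h2 : \forall w \ae P,
      `|bellman value_limit i t w - approx n.+1 i t w| <= e n.
    apply: (@bellman_lipschitz value_limit (approx n)) => j.
    - exact: (Linfty_F hG (value_limit_Linfty _ _)).
    - exact: approx_LinftyF.
    - exact: value_limit_dist.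
  apply: filterS2 h1 h2 => w h1 h2.
  rewrite (le_trans (ler_distD (approx n.+1 i t w) _ _)) // lerD //.
  by rewrite distrC.
have := ae_foralln h; apply: filterS => w hw; apply/eqP.
rewrite -subr_eq0 -normr_eq0 eq_le normr_ge0 andbT.
apply/ler_addgt0Pr => r r_gt0; rewrite add0r.
have [|N _ hN] := @tail_vanishing (r / 2); first by rewrite divr_gt0.
by rewrite (le_trans (hw N)) // (splitr r) lerD //; apply: hN => /=;
  rewrite leq_addl.
Qed.

End Existence.
End Bellman.

(** * From a solution of the system to the dynamic programming equation *)

Section System.
Set Implicit Arguments.
Unset Strict Implicit.
Context {d : measure_display} {T : measurableType d} {R : realType}.
Variables (P : probability T R) (G : nat -> set (set T)).
Hypothesis hG : filtration G.
Variable rho : nat -> (T -> R) -> (T -> R).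
Hypothesis hrho : conditional_risk_mapping P G rho.

Section Martingale.
Variable M : nat -> T -> R.
Hypothesis hM : adapted_Linfty P G M.

Let hMF t : LinftyF P (M t) := Linfty_F hG (hM t).

(** Over the horizon from t to t + 1 the aggregation also applies [rho t.+1] to [M t.+1], where it
    acts as the identity by adaptedness. *)
Lemma risk_martingale_step : risk_martingale P rho M ->
  forall t, \forall w \ae P, rho t (M t.+1) w = M t w.
Proof.
move=> mart t; have := mart t t.+1 (leqnSn t).
rewrite /aggregated_risk subSnn /= eqxx (ltn_eqF (ltnSn t)) => h.
have e : \forall w \ae P, rho t (fun w => 0 + rho t.+1 (M t.+1) w) w = rho t (M t.+1) w.
  apply: (risk_ext hrho) => //.
  - apply: LinftyD; first exact: Linfty_cst.
    exact: (risk_LinftyF hG hrho).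
  - by apply: filterS (risk_id hrho (hM t.+1)) => w ->; rewrite add0r.
by apply: filterS2 h e => w -> ->.
Qed.

Lemma step_risk_martingale :
  (forall t, \forall w \ae P, rho t (M t.+1) w = M t w) ->
  risk_martingale P rho M.
Proof.
move=> step s t st.
suff h n u : (u + n)%N = t -> \forall w \ae P,
    M u w = aggregate_steps rho n u (fun v => if v == t then M t else fun=> 0) w.
  by apply: h; exact: subnKC.
elim: n u => [|n IH] u /=.
  rewrite addn0 => ->; rewrite eqxx.
  by apply: filterS (risk_id hrho (hM t)) => w ->.
move=> ut; have -> : (u == t) = false by rewrite -ut -[X in X == _]addn0 eqn_add2l.
have hagg : LinftyF P
    (aggregate_steps rho n u.+1 (fun v => if v == t then M t else fun=> 0)).
  apply: (Linfty_F hG (t := u.+1)); apply: (aggregate_steps_Linfty hG hrho) => v.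
  by case: ifP => _; [exact: hMF|exact: Linfty_cst].
have e : \forall w \ae P, rho u (M u.+1) w = rho u (fun w => 0 +
    aggregate_steps rho n u.+1 (fun v => if v == t then M t else fun=> 0) w) w.
  apply: (risk_ext hrho); first exact: hMF.
    by apply: LinftyD => //; exact: Linfty_cst.
  by apply: filterS (IH u.+1 _) => [w ->|]; rewrite ?add0r // addSnnS.
by apply: filterS2 (step u) e => w <- ->.
Qed.

End Martingale.

Variables (m : nat) (g : 'I_m -> nat -> T -> R).
Variable (c : 'I_m -> 'I_m -> nat -> T -> R).
Hypothesis hg : forall i t, LinftyF P (g i t).
Hypothesis hc : forall i j t, LinftyF P (c i j t).
Hypothesis hc0 : forall i t, \forall w \ae P, c i i t w = 0.

Local Notation continuation := (continuation rho g c).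
Local Notation bellman := (bellman rho g c).

Lemma continuation_diag (Y : 'I_m -> nat -> T -> R) i t : LinftyF P (Y i t.+1) ->
  \forall w \ae P, continuation Y i i t w = rho t (fun w' => g i t w' + Y i t.+1 w') w.
Proof.
move=> hY; apply: (risk_ext hrho).
- exact: (tilde_costD_LinftyF hg hc).
- by apply: LinftyD => //; exact: hg.
- by apply: filterS (hc0 i t) => w h; rewrite /tilde_cost h addr0.
Qed.

Section Necessity.
Variables Y M A : 'I_m -> nat -> T -> R.
Hypothesis sol : RBSDE_solution P G rho g c Y M A.

Let hY i t : Linfty P (G t) (Y i t) := (solution_Y sol i).1 t.
Let hM i t : Linfty P (G t) (M i t) := solution_M sol i t.
Let hA i t : Linfty P (G t) (A i t) := solution_A sol i t.

Let hAS i t : Linfty P (G t) (A i t.+1).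
Proof.
by split; [case: (solution_predictable sol i)|case: (hA i t.+1)].
Qed.

(* Y_{t+1} - Delta M_{t+1} agrees almost surely with a G_t-measurable
   variable, hence it can be taken out of rho_t. *)
Lemma solution_compensated i t : exists Z, [/\ Linfty P (G t) Z,
  \forall w \ae P, Z w = Y i t.+1 w - (M i t.+1 w - M i t w) &
  \forall w \ae P, Z w = Y i t w
    - rho t (fun w => g i t w + (M i t.+1 w - M i t w)) w
    + (A i t.+1 w - A i t w)].
Proof.
exists (fun w => Y i t w
    - rho t (fun w => g i t w + (M i t.+1 w - M i t w)) w
    + (A i t.+1 w - A i t w)); split; last exact: nearW.
- apply: LinftyD; apply: LinftyB => //; apply: (risk_Linfty hrho).
  apply: LinftyD; first exact: hg.
  by apply: LinftyB; apply: (Linfty_F hG).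
- have := RBSDE_dynamics (solution_system sol) i (leqnSn t).
  by apply: filterS => w ->; rewrite big_nat1; ring.
Qed.

(** Write Y_{t+1} = (Z - M_t) + M_{t+1} with the [G t]-measurable Z of [solution_compensated].
    Taking Z - M_t out of [rho t] and using the martingale property gives rho_t(Y_{t+1}) = Z. *)
Lemma solution_M_increment i t : \forall w \ae P,
  M i t.+1 w - M i t w = Y i t.+1 w - rho t (Y i t.+1) w.
Proof.
have [Z [hZ ZE _]] := solution_compensated i t.
have hYF := Linfty_F hG (hY i t.+1); have hMF := Linfty_F hG (hM i t.+1).
have h1 : \forall w \ae P, rho t (Y i t.+1) w =
    rho t (fun w => (Z w - M i t w) + M i t.+1 w) w.
  apply: (risk_ext hrho) => //.
    apply: LinftyD => //; apply: LinftyB; first exact: (Linfty_F hG hZ).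
    exact: (Linfty_F hG (hM i t)).
  by apply: filterS ZE => w ->; ring.
have h2 := risk_translation hrho hMF (LinftyB hZ (hM i t)).
have h3 := risk_martingale_step (hM i) (solution_martingale sol i) t.
apply: filterS2 h1 (filterI ZE (filterI h2 h3)) => w -> [h [-> ->]].
by rewrite subrK h; ring.
Qed.

(** Here g_i + Y_{t+1} = Z + X, where X is the argument of [rho t] in the dynamics. Taking Z out and
    inserting its second expression leaves Y_t + Delta A_{t+1}. *)
Lemma solution_A_increment i t : \forall w \ae P,
  A i t.+1 w - A i t w = continuation Y i i t w - Y i t w.
Proof.
have [Z [hZ ZE ZE']] := solution_compensated i t.
have hYF := Linfty_F hG (hY i t.+1).
pose X w := g i t w + (M i t.+1 w - M i t w).
have hX : LinftyF P X.
  apply: LinftyD; first exact: hg.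
  by apply: LinftyB; apply: (Linfty_F hG).
have h1 : \forall w \ae P, rho t (fun w => g i t w + Y i t.+1 w) w =
    rho t (fun w => Z w + X w) w.
  apply: (risk_ext hrho).
  - by apply: LinftyD => //; exact: hg.
  - by apply: LinftyD => //; exact: (Linfty_F hG hZ).
  - by apply: filterS ZE => w ->; rewrite /X; ring.
have h2 := risk_translation hrho hX hZ.
have h3 := continuation_diag hYF.
apply: filterS2 h1 (filterI ZE' (filterI h2 h3)) => w h1 [h [h2' ->]].
by rewrite h1 h2' h /X; ring.
Qed.

(** Y lies below the barrier and, as A increases, below the value of staying. Each Skorokhod term
    vanishes, so Y equals one of the two and hence their minimum. *)
Lemma solution_bellman i t : \forall w \ae P, Y i t w = bellman Y i t w.
Proof.
have hsk := RBSDE_skorokhod (solution_system sol) i.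
have /ae_foralln hB := RBSDE_barrier (solution_system sol) i.
have /ae_foralln hinc := fun u => solution_nondecreasing sol i (leqnSn u).
have hdA := solution_A_increment i t.
apply: filterS2 hsk (filterI hB (filterI hinc hdA)) => w sk [B [inc dA]].
have terms_le0 u : (((Y i u w)%:E - switching_barrier rho g c Y i u w)
    * (A i u.+1 w - A i u w)%:E <= 0)%E.
  by rewrite mule_le0_ge0 ?sube_le0 // lee_fin subr_ge0.
have /eqP tE := npeseries_eq0 terms_le0 sk t.
apply: EFin_inj; rewrite bellman_barrierE.
have YA : Y i t w <= continuation Y i i t w by rewrite -subr_ge0 -dA subr_ge0.
move: tE (B t); case: (switching_barrier _ _ _ _ _ _ _) => [b| |] //=.
- rewrite lee_fin -EFinB -EFinM eqe mulf_eq0 !subr_eq0.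
  case/orP => /eqP h Yb; first by rewrite -EFin_min min_r -h.
  move: dA; rewrite h subrr => /esym/eqP; rewrite subr_eq0 => /eqP ->.
  by rewrite -EFin_min min_l.
(* With barrier +oo the term is -oo times Delta A, which is 0 only when Delta A = 0; then Y is the
   value of staying. *)
- rewrite min_l ?leey //; have [dA0 _|dA0] := eqVneq (A i t.+1 w) (A i t w).
    by move: dA; rewrite dA0 subrr => /esym/eqP; rewrite subr_eq0 => /eqP ->.
  have dA_gt0 : 0 < A i t.+1 w - A i t w by rewrite subr_gt0 lt_neqAle eq_sym dA0 inc.
  by rewrite gt0_mulNye // lte_fin.
Qed.

End Necessity.
End System.

(** * From the dynamic programming equation to a solution of the system *)

Section Sufficiency.
Set Implicit Arguments.
Unset Strict Implicit.
Context {d : measure_display} {T : measurableType d} {R : realType}.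
Variables (P : probability T R) (G : nat -> set (set T)).
Hypothesis hG : filtration G.
Variable rho : nat -> (T -> R) -> (T -> R).
Hypothesis hrho : conditional_risk_mapping P G rho.
Variables (m : nat) (g : 'I_m -> nat -> T -> R).
Variable (c : 'I_m -> 'I_m -> nat -> T -> R).
Hypothesis hg : forall i t, LinftyF P (g i t).
Hypothesis hc : forall i j t, LinftyF P (c i j t).
Hypothesis hc0 : forall i t, \forall w \ae P, c i i t w = 0.

Local Notation continuation := (continuation rho g c).
Local Notation bellman := (bellman rho g c).

Section FromBellman.
Variable Y : 'I_m -> nat -> T -> R.
Hypothesis hY : forall i, adapted_Linfty_vanishing P G (Y i).
Hypothesis YE : forall i t, \forall w \ae P, Y i t w = bellman Y i t w.

Let hYt i t : Linfty P (G t) (Y i t) := (hY i).1 t.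
Let hYF i t : LinftyF P (Y i t) := Linfty_F hG (hYt i t).

Let M i t w := \sum_(0 <= s < t) (Y i s.+1 w - rho s (Y i s.+1) w).
Let A i t w := \sum_(0 <= s < t) (continuation Y i i s w - Y i s w).

Let dM i t w : M i t.+1 w - M i t w = Y i t.+1 w - rho t (Y i t.+1) w.
Proof. by rewrite /M big_nat_recr //= addrAC subrr add0r. Qed.

Let dA i t w : A i t.+1 w - A i t w = continuation Y i i t w - Y i t w.
Proof. by rewrite /A big_nat_recr //= addrAC subrr add0r. Qed.

Let hM i t : Linfty P (G t) (M i t).
Proof.
apply: Linfty_sum_nat => s st; apply: LinftyB.
  exact: (Linfty_le hG st).
by apply: (Linfty_le hG (ltnW st)); exact: (risk_Linfty hrho).
Qed.

Let hAS i t : Linfty P (G t) (A i t.+1).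
Proof.
apply: Linfty_sum_nat => s st; apply: (Linfty_le hG (s := s)) => //.
by apply: LinftyB => //; exact: (continuation_Linfty hrho hg hc).
Qed.

Let hA i t : Linfty P (G t) (A i t).
Proof.
case: t => [|t]; last exact: (Linfty_le hG (leqnSn t)).
by rewrite /A; under eq_fun do rewrite big_geq //; exact: Linfty_cst.
Qed.

Let dA_ge0 i t : \forall w \ae P, A i t w <= A i t.+1 w.
Proof.
by apply: filterS (YE i t) => w h; rewrite -subr_ge0 dA subr_ge0 h bellman_le.
Qed.

(** Delta M_{t+1} is Y_{t+1} minus the [G t]-measurable rho_t(Y_{t+1}), which translation invariance
    takes out. *)
Let step_dynamics i t : \forall w \ae P,
  rho t (fun w' => g i t w' + (M i t.+1 w' - M i t w')) w =
  continuation Y i i t w - rho t (Y i t.+1) w.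
Proof.
have hr : Linfty P (G t) (fun w => 0 - rho t (Y i t.+1) w).
  by apply: LinftyB; [exact: Linfty_cst|exact: (risk_Linfty hrho)].
have hgY : LinftyF P (fun w => g i t w + Y i t.+1 w).
  by apply: LinftyD; [exact: hg|exact: hYF].
have h1 := risk_translation hrho hgY hr.
have h2 := continuation_diag hrho hg hc hc0 (hYF i t.+1).
rewrite (_ : (fun w' => g i t w' + _) =
    (fun w => (0 - rho t (Y i t.+1) w) + (g i t w + Y i t.+1 w))).
  by apply: filterS2 h1 h2 => w -> ->; ring.
by apply/funext => w; rewrite dM; ring.
Qed.

Lemma bellman_solution : exists M A, RBSDE_solution P G rho g c Y M A.
Proof.
exists M, A; split => //.
- move=> i; apply: (step_risk_martingale hG hrho) => // t.
  have hr : Linfty P (G t) (fun w => M i t w - rho t (Y i t.+1) w).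
    by apply: LinftyB => //; exact: (risk_Linfty hrho).
  rewrite (_ : M i t.+1 =
      (fun w => (M i t w - rho t (Y i t.+1) w) + Y i t.+1 w)).
    by apply: filterS (risk_translation hrho (hYF i t.+1) hr) => w ->; ring.
  by apply/funext => w; rewrite -(subrK (M i t w) (M i t.+1 w)) dM; ring.
- move=> i; split; last by move=> t; case: (hAS i t).
  by exists 0; apply: nearW => w; rewrite /A big_geq.
- move=> i s t st; have := ae_foralln (dA_ge0 i); apply: filterS => w h.
  rewrite -(subnKC st); elim: (t - s)%N => [|n IH]; first by rewrite addn0.
  by rewrite addnS (le_trans IH).
- by move=> i; apply: nearW => w; rewrite /M big_geq.
- by move=> i; apply: nearW => w; rewrite /A big_geq.
- split.
  + move=> i t u tu; have := ae_foralln (step_dynamics i); apply: filterS => w h.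
    elim: u tu => [|u IH]; first by rewrite leqn0 => /eqP ->; rewrite big_geq //; ring.
    rewrite leq_eqVlt => /predU1P[->|]; first by rewrite big_geq //; ring.
    rewrite ltnS => tu; rewrite big_nat_recr //= h.
    have := dM i u w; have := dA i u w.
    move=> /eqP; rewrite subr_eq => /eqP ->; move=> /eqP; rewrite subr_eq => /eqP ->.
    by rewrite [LHS]IH //; ring.
  + move=> i t; apply: filterS (YE i t) => w ->.
    by rewrite bellman_barrierE ge_min lexx orbT.
  (* If staying is minimal, Delta A = 0 and the product is 0 even for an infinite barrier; otherwise
     the barrier equals the finite Y and the first factor is 0. *)
  + move=> i; have := ae_foralln (YE i); apply: filterS => w h.
    apply: eseries0 => t _ _; rewrite dA.
    have := congr1 EFin (h t); rewrite bellman_barrierE.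
    case: leP => [_ [->]|_ <-]; first by rewrite subrr mule0.
    by rewrite subee // mul0e.
Qed.

End FromBellman.
End Sufficiency.

(** * Costs of strategies and the value process *)

Section Strategies.
Set Implicit Arguments.
Unset Strict Implicit.
Context {d : measure_display} {T : measurableType d} {R : realType}.
Variables (P : probability T R) (G : nat -> set (set T)).
Hypothesis hG : filtration G.
Variable rho : nat -> (T -> R) -> (T -> R).
Hypothesis hrho : conditional_risk_mapping P G rho.
Variables (m : nat) (g : 'I_m -> nat -> T -> R).
Variable (c : 'I_m -> 'I_m -> nat -> T -> R).
Hypothesis hg : forall i t, LinftyF P (g i t).
Hypothesis hc : forall i j t, LinftyF P (c i j t).
Variable Y : 'I_m -> nat -> T -> R.
Hypothesis hY : forall i, adapted_Linfty_vanishing P G (Y i).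
Hypothesis YE : forall i t, \forall w \ae P, Y i t w = bellman rho g c Y i t w.

Local Notation continuation := (continuation rho g c).
Local Notation bellman := (bellman rho g c).

Let sG t : sigma_algebra [set: T] (G t) := filtration_sigma_algebra hG t.
Let hYF i t : LinftyF P (Y i t) := Linfty_F hG ((hY i).1 t).

Section Strategy.
Variable xi : strategy G m.

Lemma mode_fibers_in t : fibers_in (G t) (mode xi t).
Proof. exact: mode_adapted. Qed.

Lemma previous_mode_fibers_in t : fibers_in (G t) (previous_mode xi t).
Proof.
case: t => [|t]; first exact: fibers_in_cst.
apply: fibers_in_sub (mode_fibers_in t).
exact: (filtration_le hG (leqnSn t)).
Qed.

Let sF : sigma_algebra [set: T] (@measurable d T) := sigma_algebra_measurable T.

Lemma strategy_cost_LinftyF t : LinftyF P (strategy_cost g c xi t).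
Proof.
apply: (Linfty_glue (f := fun w => (previous_mode xi t w, mode xi t w))
  (X := fun ij w => tilde_cost g c ij.1 ij.2 t w)) => // [|[i j]].
  apply: fibers_in_sub (filtration_sub hG (t := t)) _.
  apply: fibers_in_pair => //; last exact: mode_fibers_in.
  exact: previous_mode_fibers_in.
exact: tilde_cost_LinftyF.
Qed.

Lemma value_along_LinftyF t :
  LinftyF P (fun w => Y (previous_mode xi t w) t w).
Proof.
apply: (Linfty_glue (X := fun i w => Y i t w)) => // [|i]; last exact: hYF.
exact: fibers_in_sub (filtration_sub hG (t := t)) (previous_mode_fibers_in _).
Qed.

(** On each of the finitely many events where the previous and current modes are a fixed pair (i,
    j), the argument of [rho t] agrees with that of [continuation Y i j t]. These events lie in
    [G t], so locality applies. *)
Lemma strategy_step t : \forall w \ae P,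
  rho t (fun w' => strategy_cost g c xi t w' + Y (previous_mode xi t.+1 w') t.+1 w') w
  = continuation Y (previous_mode xi t w) (mode xi t w) t w.
Proof.
pose f w := (previous_mode xi t w, mode xi t w).
have h (ij : 'I_m * 'I_m) : \forall w \ae P, f w = ij ->
    rho t (fun w' => strategy_cost g c xi t w'
      + Y (previous_mode xi t.+1 w') t.+1 w') w
    = continuation Y ij.1 ij.2 t w.
  apply: (risk_local hG hrho).
  - apply: fibers_in_pair => //; last exact: mode_fibers_in.
    exact: previous_mode_fibers_in.
  - by apply: LinftyD; [exact: strategy_cost_LinftyF|exact: value_along_LinftyF].
  - exact: (tilde_costD_LinftyF hg hc).
  - by apply: nearW => w <-.
by apply: filterS (ae_forall_fin h) => w /(_ _ erefl).
Qed.

Lemma value_along_vanishing (e : R) : 0 < e -> \forall t \near \oo,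
  \forall w \ae P, `|Y (previous_mode xi t w) t w| <= e.
Proof.
move=> e0; have h i : \forall t \near \oo, \forall w \ae P, `|Y i t w| <= e.
  by have /vanishingP/(_ _ e0) := (hY i).2.
apply: filterS (filter_forall _ h) => t ht.
by apply: filterS (ae_forall_fin ht) => w.
Qed.

Lemma value_le_strategy t : \forall w \ae P,
  ((Y (previous_mode xi t w) t w)%:E
     <= aggregated_risk_infty rho t (strategy_cost g c xi) w)%E.
Proof.
apply: (le_aggregated_risk_infty hG hrho
  (U := fun t w => Y (previous_mode xi t w) t w)).
- exact: strategy_cost_LinftyF.
- exact: value_along_LinftyF.
- exact: value_along_vanishing.
move=> u _; have h := ae_forall_fin (fun i => YE i u).
by apply: filterS2 (strategy_step u) h => w -> ->; exact: bellman_le.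
Qed.

Lemma strategy_le_value t :
  (forall u, (t <= u)%N -> forall w,
     continuation Y (previous_mode xi u w) (mode xi u w) u w =
     bellman Y (previous_mode xi u w) u w) ->
  \forall w \ae P, (aggregated_risk_infty rho t (strategy_cost g c xi) w
    <= (Y (previous_mode xi t w) t w)%:E)%E.
Proof.
move=> opt; apply: (ge_aggregated_risk_infty hG hrho
  (U := fun t w => Y (previous_mode xi t w) t w)).
- exact: strategy_cost_LinftyF.
- exact: value_along_LinftyF.
- exact: value_along_vanishing.
move=> u tu; have h := ae_forall_fin (fun i => YE i u).
by apply: filterS2 (strategy_step u) h => w -> ->; rewrite opt.
Qed.

End Strategy.

(* The minimising mode is read off a table of comparisons taking finitely many
   values, which makes it measurable whatever the tie-breaking of [pick]. *)
Let comparisons t w : {ffun 'I_m * 'I_m * 'I_m -> bool} :=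
  [ffun q => continuation Y q.1.1 q.1.2 t w <= continuation Y q.1.1 q.2 t w].

Let best (s : 'I_m * {ffun 'I_m * 'I_m * 'I_m -> bool}) : 'I_m :=
  odflt s.1 [pick j | [forall k, s.2 (s.1, j, k)]].

Let best_optimal i t w :
  continuation Y i (best (i, comparisons t w)) t w = bellman Y i t w.
Proof.
apply/eqP; rewrite eq_le bellman_le andbT.
rewrite /best; case: pickP => [j /forallP hj|no] /=.
  by apply: le_bigmin => [|k _]; have := hj _; [move/(_ i)|move/(_ k)]; rewrite ffunE.
(* [pick] cannot fail on a table of actual comparisons, since a minimiser passes all of them; the
   default of [best] is never reached here. *)
have [j hj] := bellman_attained rho g c Y i t w.
have /negP[] := negbT (no j); apply/forallP => k.
by rewrite ffunE /= -hj bellman_le.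
Qed.

(** Holding the mode at i before t makes xi_{t-1} = i at every w; from t on each mode is optimal
    given its predecessor. *)
Let optimal_mode (i : 'I_m) (t : nat) := fix optimal_mode (u : nat) (w : T) : 'I_m :=
  if (u < t)%N then i
  else best (if u is u'.+1 then optimal_mode u' w else i, comparisons u w).

Let comparisons_fibers_in t : fibers_in (G t) (comparisons t).
Proof.
apply: fibers_in_ffun => // q; apply: fibers_in_le => //.
  by case: (continuation_Linfty hrho hg hc q.1.1 (hYF q.1.2 t.+1)).
by case: (continuation_Linfty hrho hg hc q.1.1 (hYF q.2 t.+1)).
Qed.

Let optimal_mode_adapted i t u j : G u (optimal_mode i t u @^-1` [set j]).
Proof.
have step v (p : T -> 'I_m) : fibers_in (G v) p -> fibers_in (G v)
    (fun w => if (v < t)%N then i else best (p w, comparisons v w)).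
  move=> hp; case: (v < t)%N; first exact: (fibers_in_cst (sG _) i).
  apply: (fibers_in_comp (sG v) best (f := fun w => (p w, comparisons v w))).
  exact: fibers_in_pair.
suff h : fibers_in (G u) (optimal_mode i t u) by exact: h.
elim: u => [|u IH]; apply: step; first exact: (fibers_in_cst (sG _) i).
by apply: fibers_in_sub IH; exact: (filtration_le hG (leqnSn u)).
Qed.

Let optimal_strategy i t : strategy G m := Strategy i (optimal_mode_adapted i t).

Let optimal_previous i t w : previous_mode (optimal_strategy i t) t w = i.
Proof. by case: t => [|[|t]] //=; rewrite ltnSn. Qed.

Lemma value_process : is_value_process P G rho g c (fun i t w => (Y i t w)%:E).
Proof.
move=> i t; split.
- apply: measurableT_comp; first exact: EFin_measurable.
  by apply/measurable_wrtT; case: (hYF i t).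
- move=> _ [xi hxi <-]; have := value_le_strategy xi t.
  by apply: filterS2 hxi => w <-.
(* One strategy with cost at most Y suffices: any lower bound Z of the family lies below that cost,
   hence below Y. *)
- move=> Z _ hZ; pose xi := optimal_strategy i t.
  have hxi w : previous_mode xi t w = i by exact: optimal_previous.
  have h1 : \forall w \ae P, (aggregated_risk_infty rho t (strategy_cost g c xi) w
    <= (Y (previous_mode xi t w) t w)%:E)%E.
    apply: strategy_le_value => u tu w.
    have -> : mode xi u w = best (previous_mode xi u w, comparisons u w).
      by case: u tu => [|u] tu /=; rewrite ltnNge tu.
    exact: best_optimal.
  have h2 : \forall w \ae P,
      (Z w <= aggregated_risk_infty rho t (strategy_cost g c xi) w)%E.
    by apply: hZ; exists xi => //; apply: nearW.
  by apply: filterS2 h1 h2 => w; rewrite hxi => h1 h2; exact: le_trans h1.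
Qed.

End Strategies.

(** * Uniqueness of the triple *)

Section SolutionUniqueness.
Set Implicit Arguments.
Unset Strict Implicit.
Context {d : measure_display} {T : measurableType d} {R : realType}.
Variables (P : probability T R) (G : nat -> set (set T)).
Hypothesis hG : filtration G.
Variable rho : nat -> (T -> R) -> (T -> R).
Hypothesis hrho : conditional_risk_mapping P G rho.
Variables (m : nat) (g : 'I_m -> nat -> T -> R).
Variable (c : 'I_m -> 'I_m -> nat -> T -> R).
Hypothesis hg : forall i t, LinftyF P (g i t).
Hypothesis hc : forall i j t, LinftyF P (c i j t).
Hypothesis hc0 : forall i t, \forall w \ae P, c i i t w = 0.

Lemma indistinguishableP (X X' : 'I_m -> nat -> T -> R) :
  (forall i t, \forall w \ae P, X i t w = X' i t w) -> indistinguishable P X X'.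
Proof. by move=> XX'; apply: ae_forall_fin => i; exact: ae_foralln. Qed.

Lemma ae_eq_increments (X X' : nat -> T -> R) :
  (\forall w \ae P, X 0%N w = X' 0%N w) ->
  (forall t, \forall w \ae P, X t.+1 w - X t w = X' t.+1 w - X' t w) ->
  forall t, \forall w \ae P, X t w = X' t w.
Proof.
move=> X0 dX; elim=> [//|t IH]; apply: filterS2 IH (dX t) => w XX'.
by rewrite XX' => /addIr.
Qed.

Lemma solution_unique (Y M A Y' M' A' : 'I_m -> nat -> T -> R) :
  RBSDE_solution P G rho g c Y M A -> RBSDE_solution P G rho g c Y' M' A' ->
  [/\ indistinguishable P Y' Y, indistinguishable P M' M
    & indistinguishable P A' A].
Proof.
move=> sol sol'.
have hY i t : LinftyF P (Y i t) := Linfty_F hG ((solution_Y sol i).1 t).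
have hY' i t : LinftyF P (Y' i t) := Linfty_F hG ((solution_Y sol' i).1 t).
have YY' : forall i t, \forall w \ae P, Y' i t w = Y i t w.
  apply: (bellman_fixpoint_unique hG hrho hg hc hY' hY).
  - exact: (solution_bellman hG hrho hg hc hc0 sol').
  - exact: (solution_bellman hG hrho hg hc hc0 sol).
  - by move=> i; case: (solution_Y sol' i).
  - by move=> i; case: (solution_Y sol i).
split; apply: indistinguishableP => // i; apply: ae_eq_increments => [|t].
- by apply: filterS2 (solution_M0 sol i) (solution_M0 sol' i) => w -> ->.
- have h := solution_M_increment hG hrho hg sol i t.
  have h' := solution_M_increment hG hrho hg sol' i t.
  have e := risk_ext hrho t (hY' i t.+1) (hY i t.+1) (YY' i t.+1).
  by apply: filterS3 (filterI h h') e (YY' i t.+1) => w [-> ->] -> ->.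
- by apply: filterS2 (solution_A0 sol i) (solution_A0 sol' i) => w -> ->.
- have h := solution_A_increment hG hrho hg hc hc0 sol i t.
  have h' := solution_A_increment hG hrho hg hc hc0 sol' i t.
  have e : \forall w \ae P,
      continuation rho g c Y' i i t w = continuation rho g c Y i i t w.
    apply: (risk_ext hrho); [exact: (tilde_costD_LinftyF hg hc)..|].
    by apply: filterS (YY' i t.+1) => w ->.
  by apply: filterS3 (filterI h h') e (YY' i t) => w [-> ->] -> ->.
Qed.

End SolutionUniqueness.

Theorem theorem3p9 (d : measure_display) (T : measurableType d) (R : realType)
    (P : probability T R) (G : nat -> set (set T)) (hG : filtration G)
    (rho : nat -> (T -> R) -> (T -> R))
    (hrho : conditional_risk_mapping P G rho)
    (m : nat) (g : 'I_m -> nat -> T -> R)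
    (c : 'I_m -> 'I_m -> nat -> T -> R)
    (hg : forall i t, LinftyF P (g i t))
    (hc : forall i j t, LinftyF P (c i j t))
    (hc0 : forall i t, \forall w \ae P, c i i t w = 0)
    (gbar : nat -> T -> R) (hgbar : HF P gbar)
    (hbound : forall t i j,
       \forall w \ae P, `|tilde_cost g c i j t w| <= gbar t w) :
  (exists Y M A : 'I_m -> nat -> T -> R,
     RBSDE_solution P G rho g c Y M A /\
     forall Y' M' A' : 'I_m -> nat -> T -> R,
       RBSDE_solution P G rho g c Y' M' A' ->
       [/\ indistinguishable P Y' Y, indistinguishable P M' M
         & indistinguishable P A' A]) /\
  (forall Y M A : 'I_m -> nat -> T -> R,
     RBSDE_solution P G rho g c Y M A ->
     is_value_process P G rho g c (fun i t w => (Y i t w)%:E)).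

Proof.
have [_ [k [k_ge0 k_cvg gbar_le]]] := hgbar.
have tilde_le t i j : \forall w \ae P, `|tilde_cost g c i j t w| <= k t.
  apply: filterS2 (hbound t i j) (gbar_le t) => w h h'.
  exact: le_trans h (le_trans (ler_norm _) h').
split; last first.
  move=> Y M A sol; apply: (value_process hG hrho hg hc (solution_Y sol)).
  exact: (solution_bellman hG hrho hg hc hc0 sol).
pose Y := value_limit rho g c.
have hY : forall i, adapted_Linfty_vanishing P G (Y i).
  exact: (value_limit_vanishing hG hrho hg hc k_ge0 k_cvg tilde_le).
have YE : forall i t, \forall w \ae P, Y i t w = bellman rho g c Y i t w.
  exact: (value_limit_bellman hG hrho hg hc k_ge0 k_cvg tilde_le).
have [M [A sol]] := bellman_solution hG hrho hg hc hc0 hY YE.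
exists Y, M, A; split => // Y' M' A'.
exact: (solution_unique hG hrho hg hc hc0 sol).
Qed.
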